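(* The polynomials in $\mathbb{Z}[x_1,\ldots , x_n]$ that are both a fundamental (respectively, monomial) slide polynomial and a Young fundamental (respectively, monomial) slide polynomial are exactly the fundamental (respectively, monomial) quasisymmetric polynomials in $n$ variables. In other words, $\{\mathfrak F_a\}\cap \{\hat{\mathfrak F}_b\} = \{F_\alpha(x_1, \ldots , x_n)\}$ and $\{\mathfrak M_a\}\cap \{\hat{\mathfrak M}_b\} = \{M_\alpha(x_1, \ldots , x_n)\}$.
   Context: Weak compositions have length $n$. The fundamental slide polynomial $\mathfrak F_a$ is the generating function of fillings of the diagram of $a$ (row $i$ has $a_i$ left-justified boxes) with positive entries, rows weakly decreasing, no entry in row $i$ greater than $i$, and every entry in a lower row strictly smaller than every entry in a higher row; the monomial slide polynomial $\mathfrak M_a$ uses the subset of these fillings with all entries in a row equal. The Young versions are $\hat{\mathfrak F}_a(x_1,\ldots,x_n)=\mathfrak F_{\mathrm{rev}(a)}(x_n,\ldots,x_1)$ and $\hat{\mathfrak M}_a(x_1,\ldots,x_n)=\mathfrak M_{\mathrm{rev}(a)}(x_n,\ldots,x_1)$, $\mathrm{rev}$ denoting reversal (equivalently generated by fillings with entries in $\{1,\ldots,n\}$, rows weakly increasing, entries in row $i$ at least $i$, lower-row entries strictly smaller than higher-row entries, resp. also constant rows). $F_\alpha$ and $M_\alpha$ are Gessel's fundamental and monomial quasisymmetric polynomials, $\alpha$ ranging over compositions with at most $n$ parts. *)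

(* Defs.v *)
From HB Require Import structures.
From mathcomp Require Import all_boot all_order all_algebra.
From mathcomp Require Export mpoly.

Set Implicit Arguments.
Unset Strict Implicit.
Unset Printing Implicit Defensive.

Import GRing.Theory.
Local Open Scope ring_scope.

(** Weak compositions of length [n] are [n]-tuples of naturals.  Everything is
    0-based: row [i : 'I_n], entry [k : 'I_n] and variable ['X_k] stand for
    row i+1, entry k+1 and x_(k+1).  Row 0 is the lowest row, so "lower row"
    means smaller row index.  Filling entries are taken in ['I_n]; this loses
    nothing, since an entry in row i is at most i. *)

Section Slide.
Variables (n : nat) (a : n.-tuple nat).

Definition box : finType := {i : 'I_n & 'I_(tnth a i)}.
Definition brow (b : box) : 'I_n := tag b.
Definition bcol (b : box) : nat := tagged b.

Definition filling := {ffun box -> 'I_n}.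

Definition fund_filling (T : filling) : bool :=
  [&& [forall b : box, forall c : box,
         (brow b == brow c) && (bcol b <= bcol c)%N ==> (T c <= T b)%N],
      [forall b : box, (T b <= brow b)%N]
    & [forall b : box, forall c : box,
         (brow b < brow c)%N ==> (T b < T c)%N]].

Definition mono_filling (T : filling) : bool :=
  fund_filling T &&
  [forall b : box, forall c : box, (brow b == brow c) ==> (T b == T c)].

Definition filling_weight (T : filling) : {mpoly int[n]} :=
  \prod_(b : box) 'X_(T b).

Definition fund_slide : {mpoly int[n]} :=
  \sum_(T : filling | fund_filling T) filling_weight T.

Definition mono_slide : {mpoly int[n]} :=
  \sum_(T : filling | mono_filling T) filling_weight T.

End Slide.

(** [f(x_1, ..., x_n) |-> f(x_n, ..., x_1)] *)
Definition rev_vars (n : nat) (p : {mpoly int[n]}) : {mpoly int[n]} :=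
  comp_mpoly [tuple 'X_(rev_ord i) | i < n] p.

Definition young_fund_slide (n : nat) (a : n.-tuple nat) : {mpoly int[n]} :=
  rev_vars (fund_slide [tuple of rev a]).

Definition young_mono_slide (n : nat) (a : n.-tuple nat) : {mpoly int[n]} :=
  rev_vars (mono_slide [tuple of rev a]).

Definition is_comp (al : seq nat) : bool := all (fun m => 0 < m)%N al.

(** [M_al = \sum_(i_1 < ... < i_k) x_(i_1)^(al_1) ... x_(i_k)^(al_k)] *)
Definition mono_qsym (n : nat) (al : seq nat) : {mpoly int[n]} :=
  \sum_(t : {ffun 'I_(size al) -> 'I_n} |
          [forall u : 'I_(size al), forall v : 'I_(size al),
             (u < v)%N ==> (t u < t v)%N])
    \prod_(u < size al) 'X_(t u) ^+ nth 0%N al u.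

(** [{al_1, al_1 + al_2, ..., al_1 + ... + al_(k-1)}] *)
Definition comp_set (al : seq nat) : seq nat :=
  [seq sumn (take m al) | m <- iota 1 (size al).-1].

(** With [N = al_1 + ... + al_k], [F_al] is the sum of [x_(i_1) ... x_(i_N)]
    over [i_1 <= ... <= i_N] with [i_j < i_(j+1)] whenever [j] lies in
    [comp_set al].  Since [t] is 0-based, the pair [(i_j, i_(j+1))] is
    [(t u, t v)] with [v = u.+1 = j]. *)
Definition fund_qsym (n : nat) (al : seq nat) : {mpoly int[n]} :=
  \sum_(t : {ffun 'I_(sumn al) -> 'I_n} |
          [forall u : 'I_(sumn al), forall v : 'I_(sumn al),
             (v == u.+1 :> nat) ==>
             (if (v : nat) \in comp_set al then t u < t v else t u <= t v)%N])
    \prod_(u < sumn al) 'X_(t u).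

(* Main.v *)
(** Reading fillings as words, [F_a] is the sum over the weakly increasing words
    [t] that increase strictly between the rows of [a] and satisfy [t <= r_a]
    pointwise, where [r_a u] is the row of the [u]-th letter; the Young version
    has [t >= r_a] instead, and the monomial versions also ask [t] to be
    constant on rows.  The strictness condition depends only on the composition
    [al] obtained from [a] by deleting zeros, and it forces every word between
    the row words of [al 0...0] and of [0...0 al]; so these two weak
    compositions give the quasisymmetric polynomial of [al].  If [F_a] equals
    the Young polynomial of [b], the pointwise largest word is [r_a] on one side
    and the row word of [0...0 flat(b)] on the other, so [a = 0...0 flat(b)]. *)

Require Import Defs.
From mathcomp Require Import all_boot all_order all_algebra.
From mathcomp Require Import zify.

Set Implicit Arguments.
Unset Strict Implicit.
Unset Printing Implicit Defensive.

Import GRing.Theory.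
Local Open Scope nat_scope.

Local Notation row := reshape_index.
Local Notation psum s m := (sumn (take m s)).
Local Notation flat := (filter (fun m => 0 < m)).

(** * Prefix sums and row indices *)

Lemma psum_le s m m' : m <= m' -> psum s m <= psum s m'.
Proof.
by move=> le; rewrite -(subnKC le) takeD sumn_cat leq_addr.
Qed.

Lemma psumS s m : psum s m.+1 = psum s m + nth 0 s m.
Proof.
case: (ltnP m (size s)) => h; first by rewrite (take_nth 0 h) sumn_rcons.
by rewrite nth_default // addn0 !take_oversize // ltnW.
Qed.

Lemma psum_row s u : psum s (row s u) <= u.
Proof. by rewrite -[X in _ <= X](reshape_indexK s) leq_addr. Qed.

Lemma psum_rowS s u : u < sumn s -> u < psum s (row s u).+1.
Proof.
move=> /reshape_offsetP lt_u; rewrite -[X in X < _](reshape_indexK s) psumS.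
by rewrite /flatten_index ltn_add2l.
Qed.

Lemma rowE s u i : psum s i <= u < psum s i.+1 -> row s u = i.
Proof.
rewrite psumS => /andP[le_u lt_u]; rewrite -(subnKC le_u).
by apply: flatten_indexKl; lia.
Qed.

(** Monotonicity of prefix sums makes [row s] adjoint to [psum s], so comparisons of rows become
    comparisons of positions with prefix sums. *)
Lemma leq_row s u m : u < sumn s -> (m <= row s u) = (psum s m <= u).
Proof.
move=> lt_u; apply/idP/idP => [le_m | le_u].
  exact: leq_trans (psum_le _ le_m) (psum_row _ _).
rewrite leqNgt; apply/negP => /(psum_le s) lt_m.
by have := psum_rowS lt_u; lia.
Qed.

Lemma row_mono s u v : u <= v -> v < sumn s -> row s u <= row s v.
Proof.
by move=> le_uv lt_v; rewrite leq_row // (leq_trans (psum_row _ _)).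
Qed.

(** Expresses row order through the set of prefix sums alone, which makes it insensitive to zero
    parts and comparable with [comp_set]. *)
Lemma row_ltP s u v : u < sumn s -> v < sumn s ->
  reflect (exists m, u < psum s m <= v) (row s u < row s v).
Proof.
move=> lt_u lt_v; apply: (iffP idP) => [lt_r | [m /andP[u_m m_v]]].
  by exists (row s u).+1; rewrite psum_rowS // -leq_row.
have m_le : m <= row s v by rewrite leq_row.
by apply: leq_trans m_le; rewrite ltnNge leq_row // -ltnNge.
Qed.

(** * Deleting zeros, reversal and padding *)

(** A zero part only repeats the preceding prefix sum, so deleting it loses no value. *)
Lemma psum_flat s x :
  (exists m, psum s m = x) <-> (exists m, psum (flat s) m = x).
Proof.
split.
  case=> m <-; exists (size (flat (take m s))).
  rewrite -{2}(cat_take_drop m s) filter_cat take_size_cat //.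
  by elim: (take m s) => //= -[|h] r /= ->.
case=> m <-; elim: s m => [|[|h] s IHs] m /=; first by exists 0.
  by have [k <-] := IHs m; exists k.+1.
case: m => [|m]; first by exists 0.
by have [k /= <-] := IHs m; exists k.+1.
Qed.

Lemma sumn_flat s : sumn (flat s) = sumn s.
Proof. by elim: s => //= -[|h] s /= ->. Qed.

Lemma row_lt_flat s u v : u < sumn s -> v < sumn s ->
  (row (flat s) u < row (flat s) v) = (row s u < row s v).
Proof.
move=> lt_u lt_v; apply/row_ltP/row_ltP; rewrite ?sumn_flat //.
  by case=> m uv; have [k E] := (psum_flat s _).2 (ex_intro _ m erefl);
    exists k; rewrite E.
by case=> m uv; have [k E] := (psum_flat s _).1 (ex_intro _ m erefl);
  exists k; rewrite E.
Qed.

Lemma row_eq_flat s u v : u < sumn s -> v < sumn s ->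
  (row (flat s) u == row (flat s) v) = (row s u == row s v).
Proof.
by move=> lt_u lt_v; rewrite !eqn_leq; congr (_ && _);
  rewrite leqNgt row_lt_flat // -leqNgt.
Qed.

Lemma row_rev s u : u < sumn s ->
  row (rev s) (sumn s - u.+1) = size s - (row s u).+1.
Proof.
move=> lt_u; apply: rowE.
have lt_r := reshape_indexP lt_u.
have -> : (size s - (row s u).+1).+1 = size s - row s u by lia.
rewrite !take_rev !sumn_rev (subKn lt_r) (subKn (ltnW lt_r)).
have E i : sumn (drop i s) = sumn s - psum s i.
  by rewrite -{2}(cat_take_drop i s) sumn_cat addKn.
rewrite !E; have := psum_row s u; have := psum_rowS lt_u; lia.
Qed.

Lemma row_nseq_cat z s u : u < sumn s -> row (nseq z 0 ++ s) u = z + row s u.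
Proof.
move=> lt_u; apply: rowE.
have E i : psum (nseq z 0 ++ s) (z + i) = psum s i.
  by rewrite takeD take_size_cat ?size_nseq // drop_size_cat ?size_nseq //
    sumn_cat sumn_nseq.
by rewrite -addnS !E psum_row psum_rowS.
Qed.

Lemma row_cat s s' u : u < sumn s -> row (s ++ s') u = row s u.
Proof.
move=> lt_u; have lt_r := reshape_indexP lt_u; apply: rowE.
by rewrite !takel_cat ?(ltnW lt_r) // psum_row psum_rowS.
Qed.

Lemma row_surj al i : is_comp al -> i < size al ->
  exists2 u, u < sumn al & row al u = i.
Proof.
move=> /all_nthP pos lt_i; have ci := pos 0 i lt_i.
by exists (flatten_index al i 0); rewrite (flatten_indexP, flatten_indexKl).
Qed.

(** For adjacent positions the prefix sum given by [row_ltP] can only be [u.+1]; since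
    [0 < u.+1 < sumn al], its index lies strictly between 0 and [size al]. *)
Lemma mem_comp_set al u : is_comp al -> u.+1 < sumn al ->
  (u.+1 \in comp_set al) = (row al u < row al u.+1).
Proof.
move=> c_al lt_u; apply/mapP/row_ltP; rewrite ?(ltnW lt_u) //.
  by case=> m _ E; exists m; rewrite -E !leqnn.
case=> m um; have E : psum al m = u.+1 by lia.
exists m => //; rewrite mem_iota.
have m_gt0 : 0 < m by case: m E {um} => //; rewrite take0.
have : m < size al; last by lia.
rewrite ltnNge; apply/negP => /take_oversize E'.
by rewrite E' in E; rewrite E ltnn in lt_u.
Qed.

(** * Words *)

(* Reading a filling row by row upwards, each row from right to left, turns it
   into a word that is weakly increasing, strictly so between rows, and (for
   monomial fillings, [mono = true]) constant on rows. *)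
Definition word (mono : bool) n N (s : seq nat) (t : {ffun 'I_N -> 'I_n}) :=
  [forall u : 'I_N, forall v : 'I_N,
    [&& (u <= v) ==> (t u <= t v), (row s u < row s v) ==> (t u < t v)
      & mono ==> (row s u == row s v) ==> (t u == t v)]].

Lemma wordP (mono : bool) n N s (t : {ffun 'I_N -> 'I_n}) :
  reflect [/\ forall u v : 'I_N, u <= v -> t u <= t v,
              forall u v : 'I_N, row s u < row s v -> t u < t v
            & mono -> forall u v : 'I_N, row s u = row s v -> t u = t v]
          (word mono s t).
Proof.
apply: (iffP idP) => [w | [w1 w2 w3]].
  split=> [u v|u v|m u v]; move/forallP/(_ u)/forallP/(_ v)/and3P: w;
    case=> /implyP w1 /implyP w2 /implyP w3 // /eqP e.
  by apply/eqP; move: e; apply/implyP/w3.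
apply/forallP=> u; apply/forallP=> v; apply/and3P.
split; apply/implyP; [exact: w1 | exact: w2 |].
by move=> m; apply/implyP=> /eqP e; apply/eqP; apply: w3.
Qed.

Lemma word_flat (mono : bool) n s N (t : {ffun 'I_N -> 'I_n}) : N = sumn s ->
  word mono (flat s) t = word mono s t.
Proof.
move=> eN; subst N; apply: eq_forallb => u; apply: eq_forallb => v.
by rewrite row_lt_flat ?row_eq_flat.
Qed.

(** No row of a composition is empty, so strictness costs at least one letter per row, counted from
    the bottom row for the first bound and from the top row for the second. *)
Lemma word_bounds (mono : bool) n al N (t : {ffun 'I_N -> 'I_n}) (u : 'I_N) :
  N = sumn al -> is_comp al -> word mono al t ->
  row al u <= t u /\ t u + size al <= n + row al u.
Proof.
move=> eN; subst N; move=> c_al /wordP[_ strict _]; split.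
  move E : (row al u) => d; elim: d u E => // d IHd u E.
  have lt_d : d < size al.
    by apply: ltnW; rewrite -E; apply: reshape_indexP.
  have [v lt_v Ev] := row_surj c_al lt_d.
  have := strict (Ordinal lt_v) u; rewrite /= Ev E => /(_ (leqnn _)).
  by have := IHd (Ordinal lt_v) Ev; lia.
have lt_r (v : 'I_(sumn al)) := reshape_indexP (ltn_ord v).
(* Here [d] counts the rows above that of [v]; each needs a larger letter below [n]. *)
suff H d (v : 'I_(sumn al)) : row al v + d.+1 = size al -> t v + d < n.
  have lt_u := lt_r u.
  by have := H (size al - (row al u).+1) u; lia.
elim: d v => [|d IHd] v E; first by rewrite addn0.
have lt_v' : (row al v).+1 < size al by lia.
have [w lt_w Ew] := row_surj c_al lt_v'.
have := strict v (Ordinal lt_w); rewrite /= Ew => /(_ (leqnn _)).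
have := IHd (Ordinal lt_w); rewrite /= Ew; lia.
Qed.

(** * Fillings correspond to words *)

Section Boxes.
Variables (n : nat) (a : n.-tuple nat).

Lemma row_ord_subproof (u : 'I_(sumn a)) : row a u < n.
Proof. by have := reshape_indexP (ltn_ord u); rewrite size_tuple. Qed.

Definition row_ord (u : 'I_(sumn a)) : 'I_n := Ordinal (row_ord_subproof u).

Lemma to_box_subproof (u : 'I_(sumn a)) :
  reshape_offset a u < tnth a (row_ord u).
Proof. by rewrite (tnth_nth 0); apply: reshape_offsetP. Qed.

(** The column is reversed because rows of a filling weakly decrease, whereas words weakly
    increase. *)
Definition to_box (u : 'I_(sumn a)) : box a :=
  Tagged (fun i => 'I_(tnth a i)) (rev_ord (Ordinal (to_box_subproof u))).

Lemma rev_bcol (b : box a) : rev_ord (tagged b) < nth 0 a (brow b).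
Proof. by rewrite -tnth_nth; apply: ltn_ord. Qed.

Definition of_box (b : box a) : 'I_(sumn a) :=
  Ordinal (flatten_indexP (rev_bcol b)).

Lemma row_of_box b : row_ord (of_box b) = brow b.
Proof. by apply: val_inj; rewrite /= flatten_indexKl // rev_bcol. Qed.

Lemma to_boxK : cancel to_box of_box.
Proof.
move=> u; apply: val_inj; rewrite -[RHS](reshape_indexK a).
by congr (flatten_index a _ _); apply: (congr1 val (rev_ordK _)).
Qed.

Lemma of_box_inj : injective of_box.
Proof.
move=> b c E; have := congr1 row_ord E; rewrite !row_of_box.
case: b c E => [i x] [j y] E /= Eij; rewrite /brow /= in Eij.
case: j / Eij y E => y /(congr1 val) /= /addnI E.
by congr existT; apply: (can_inj rev_ordK); apply: val_inj.
Qed.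

Lemma of_boxK : cancel of_box to_box.
Proof. by move=> b; apply: of_box_inj; rewrite to_boxK. Qed.

Lemma leq_of_box (b c : box a) : brow b = brow c ->
  (of_box c <= of_box b) = (bcol b <= bcol c).
Proof.
case: b c => [i x] [j y]; rewrite /brow /= => Eij.
case: j / Eij y => y.
rewrite /of_box /bcol /= /flatten_index /=.
by have := ltn_ord x; have := ltn_ord y; lia.
Qed.

(** Collects equal factors: used to obtain the powers in [mono_qsym] and the exponents of the row
    word. *)
Lemma big_row (R : Type) (idx : R) (op : Monoid.com_law idx) (F : 'I_n -> R) :
  \big[op/idx]_(u < sumn a) F (row_ord u) =
  \big[op/idx]_(i < n) \big[op/idx]_(c < tnth a i) F i.
Proof.
rewrite (sig_big_dep predT (fun _ => predT) (fun i _ => F i)) /=.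
rewrite (reindex of_box); last first.
  by exists to_box => b _; [apply: of_boxK | apply: to_boxK].
by apply: eq_big => // b _; rewrite row_of_box.
Qed.

Definition word_filling (t : {ffun 'I_(sumn a) -> 'I_n}) : filling a :=
  [ffun b => t (of_box b)].

Definition filling_word (T : filling a) : {ffun 'I_(sumn a) -> 'I_n} :=
  [ffun u => T (to_box u)].

Lemma word_fillingK : cancel word_filling filling_word.
Proof. by move=> t; apply/ffunP=> u; rewrite !ffunE to_boxK. Qed.

Lemma filling_wordK : cancel filling_word word_filling.
Proof. by move=> T; apply/ffunP=> b; rewrite !ffunE of_boxK. Qed.

Definition bounded (t : {ffun 'I_(sumn a) -> 'I_n}) :=
  [forall u, t u <= row a u].

(** Within a row the filling condition is monotonicity of the word; across rows the weak inequality
    follows from the strict one. *)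
Lemma fund_word_filling t :
  fund_filling (word_filling t) = word false a t && bounded t.
Proof.
have rE b : row a (of_box b) = brow b by rewrite -row_of_box.
apply/and3P/andP => [[/forallP F1 /forallP F2 /forallP F3] |
                     [/wordP[w1 w2 _] /forallP bd]].
  have strict (u v : 'I_(sumn a)) : row a u < row a v -> t u < t v.
    rewrite -(to_boxK u) -(to_boxK v) !rE => lt.
    by have /forallP/(_ (to_box v))/implyP := F3 (to_box u); rewrite !ffunE; apply.
  split; last first.
    by apply/forallP=> u; rewrite -(to_boxK u) rE; have := F2 (to_box u); rewrite ffunE.
  apply/wordP; split=> // u v le_uv.
  have := row_mono le_uv (ltn_ord v).
  rewrite leq_eqVlt => /orP[/eqP E | /strict/ltnW //].
  have /forallP/(_ (to_box u))/implyP := F1 (to_box v).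
  rewrite !ffunE !to_boxK; apply; rewrite -leq_of_box ?to_boxK //.
    by rewrite le_uv andbT; apply/eqP/val_inj; rewrite /= E.
  by apply: val_inj; rewrite /= E.
split; last 1 first.
- apply/forallP=> b; apply/forallP=> c; apply/implyP=> lt; rewrite !ffunE.
  by apply: w2; rewrite !rE.
- apply/forallP=> b; apply/forallP=> c; apply/implyP=> /andP[/eqP E le].
  by rewrite !ffunE; apply: w1; rewrite leq_of_box.
- by apply/forallP=> b; rewrite ffunE; have := bd (of_box b); rewrite rE.
Qed.

Lemma mono_word_filling t :
  mono_filling (word_filling t) = word true a t && bounded t.
Proof.
have rE b : row a (of_box b) = brow b by rewrite -row_of_box.
rewrite /mono_filling fund_word_filling andbAC; congr (_ && _).
apply/andP/idP => [[/wordP[w1 w2 _] /forallP C] | /wordP[w1 w2 w3]].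
  apply/wordP; split=> // _ u v; rewrite -(to_boxK u) -(to_boxK v) !rE => E.
  have /forallP/(_ (to_box v))/implyP := C (to_box u).
  by rewrite !ffunE => H; apply/eqP/H/eqP/val_inj.
split; first exact/wordP.
apply/forallP=> b; apply/forallP=> c; apply/implyP=> /eqP E; rewrite !ffunE.
by apply/eqP/w3 => //; rewrite !rE E.
Qed.

End Boxes.

(** * Slide and Young slide polynomials as sums over words *)

Definition slide (mono : bool) n (a : n.-tuple nat) : {mpoly int[n]} :=
  if mono then mono_slide a else fund_slide a.

Local Notation mon t := (\prod_u 'X_(t u))%R.

Lemma slideE (mono : bool) n (a : n.-tuple nat) :
  slide mono a =
  (\sum_(t : {ffun 'I_(sumn a) -> 'I_n} | word mono a t && bounded t) mon t)%R.
Proof.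
have bij : bijective (@word_filling n a).
  by exists (@filling_word n a); [apply: word_fillingK | apply: filling_wordK].
have wE (t : {ffun 'I_(sumn a) -> 'I_n}) :
  filling_weight (word_filling t) = (\prod_u 'X_(t u))%R.
  rewrite /filling_weight [RHS](reindex (@of_box n a)).
    by apply: eq_bigr => b _; rewrite ffunE.
  by exists (@to_box n a) => b _; [apply: of_boxK | apply: to_boxK].
rewrite /slide; case: mono; rewrite /mono_slide /fund_slide.
  rewrite (reindex _ (onW_bij _ bij)); apply: eq_big => [t|t _] //.
  by rewrite mono_word_filling.
rewrite (reindex _ (onW_bij _ bij)); apply: eq_big => [t|t _] //.
by rewrite fund_word_filling.
Qed.

(** A free length [N] lets words for different weak compositions of the same sum share one type. *)
Lemma slide_words (mono : bool) n (a : n.-tuple nat) N : N = sumn a ->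
  slide mono a =
  (\sum_(t : {ffun 'I_N -> 'I_n} |
       word mono a t && [forall u : 'I_N, (t u <= row a u)%N]) mon t)%R.
Proof. by move->; apply: slideE. Qed.

(** Reversing positions matches [rev] on the composition and complementing letters matches
    [rev_vars]; together they keep words increasing. *)
Definition rev_word n N (t : {ffun 'I_N -> 'I_n}) : {ffun 'I_N -> 'I_n} :=
  [ffun u => rev_ord (t (rev_ord u))].

Lemma rev_wordK n N : involutive (@rev_word n N).
Proof. by move=> t; apply/ffunP=> u; rewrite !ffunE !rev_ordK. Qed.

Lemma row_rev_ord s N (u : 'I_N) : N = sumn s ->
  row (rev s) (rev_ord u) = size s - (row s u).+1.
Proof. by move=> E; subst N; apply: row_rev. Qed.

Lemma word_rev (mono : bool) n s N (t : {ffun 'I_N -> 'I_n}) : N = sumn s ->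
  word mono (rev s) (rev_word t) = word mono s t.
Proof.
have imp s' (t' : {ffun 'I_N -> 'I_n}) : N = sumn s' ->
    word mono s' t' -> word mono (rev s') (rev_word t').
  move=> eN /wordP[w1 w2 w3].
  have lt_r (u : 'I_N) : row s' u < size s'.
    by apply: reshape_indexP; rewrite -eN.
  apply/wordP; split=> [u v le|u v|m u v]; rewrite !ffunE.
  - have := w1 (rev_ord v) (rev_ord u); rewrite /=.
    by have := ltn_ord (t' (rev_ord u)); have := ltn_ord (t' (rev_ord v)); lia.
  - rewrite -{1}(rev_ordK u) -{1}(rev_ordK v) !row_rev_ord // => lt.
    have := w2 (rev_ord v) (rev_ord u).
    have := ltn_ord (t' (rev_ord u)); have := ltn_ord (t' (rev_ord v)).
    by rewrite [X in _ -> _ -> _ -> X]/=; lia.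
  rewrite -{1}(rev_ordK u) -{1}(rev_ordK v) !row_rev_ord // => E.
  congr rev_ord; apply: w3 => //.
  by have := lt_r (rev_ord u); have := lt_r (rev_ord v); lia.
move=> eN; apply/idP/idP; last exact: imp.
(* The converse is [imp] for the reversed data, as both reversals are involutive. *)
by move/imp; rewrite sumn_rev revK rev_wordK; apply.
Qed.

Definition young_slide (mono : bool) n (b : n.-tuple nat) : {mpoly int[n]} :=
  rev_vars (slide mono [tuple of rev b]).

Lemma young_slide_words (mono : bool) n (b : n.-tuple nat) N : N = sumn b ->
  young_slide mono b =
  (\sum_(t : {ffun 'I_N -> 'I_n} |
       word mono b t && [forall u : 'I_N, (row b u <= t u)%N]) mon t)%R.
Proof.
move=> eN; rewrite /young_slide /rev_vars (@slide_words _ _ _ N) ?sumn_rev //.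
rewrite raddf_sum (reindex_inj (inv_inj (@rev_wordK n N))) /=.
apply: eq_big => [t | t _].
  rewrite word_rev //; congr (_ && _).
  (* Complementing letter and row turns the slide bound into the Young bound. *)
  have E (u : 'I_N) :
      (rev_word t (rev_ord u) <= row (rev b) (rev_ord u)) = (row b u <= t u).
    rewrite row_rev_ord // ffunE rev_ordK size_tuple /=.
    have := ltn_ord (t u).
    by have := @reshape_indexP b u; rewrite -eN size_tuple ltn_ord => /(_ isT); lia.
  apply/forallP/forallP => H u; first by rewrite -E.
  by rewrite -(rev_ordK u) E.
rewrite rmorph_prod (reindex_inj rev_ord_inj) /=.
by apply: eq_bigr => u _; rewrite comp_mpolyXU -tnth_nth tnth_mktuple ffunE !rev_ordK.
Qed.

(** * Quasisymmetric polynomials as sums over words *)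

Lemma fund_qsym_words n al : is_comp al ->
  fund_qsym n al =
  (\sum_(t : {ffun 'I_(sumn al) -> 'I_n} | word false al t) mon t)%R.
Proof.
move=> c_al; apply: eq_bigl => t; apply/forallP/wordP => [F | [w1 w2 _] u].
  have F' (u v : 'I_(sumn al)) : v = u.+1 :> nat ->
      t u <= t v /\ (row al u < row al v -> t u < t v).
    move=> E; have /forallP/(_ v)/implyP := F u.
    rewrite E mem_comp_set -?E // eqxx => /(_ isT).
    by case: ifP => [_ lt|_ le]; split=> //; apply: ltnW.
  (* The conditions on adjacent positions propagate by induction on the distance [d]. *)
  suff H d (u v : 'I_(sumn al)) : v = u + d :> nat ->
      t u <= t v /\ (row al u < row al v -> t u < t v).
    split=> // u v => [le | lt].
      by have [] := H (v - u) u v; rewrite ?subnKC.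
    have le : u <= v.
      by rewrite leqNgt; apply/negP => /ltnW/row_mono/(_ (ltn_ord u)); lia.
    by have [|_ ->] // := H (v - u) u v; rewrite subnKC.
  elim: d v => [|d IHd] v E.
    have -> : v = u by apply: val_inj; rewrite /= E addn0.
    by rewrite leqnn !ltnn.
  have lt_w : u + d < sumn al by have := ltn_ord v; lia.
  pose w : 'I_(sumn al) := Ordinal lt_w.
  have [le1 lt1] := IHd w erefl.
  have [|le2 lt2] := F' w v; first by rewrite E addnS.
  split=> [|lt]; first exact: leq_trans le1 le2.
  (* The row increases either before [w] or in the last step; either one gives strictness. *)
  have [/lt1 lt_uw|le_wu] := ltnP (row al u) (row al w).
    exact: leq_trans lt_uw le2.
  by apply: leq_ltn_trans le1 (lt2 _); apply: leq_ltn_trans le_wu lt.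
apply/forallP=> v; apply/implyP=> /eqP E; rewrite E mem_comp_set -?E //.
by case: ifP => [|_]; [apply: w2 | apply: w1; rewrite E].
Qed.

(** A word constant on rows is determined by its letter at the first position of each row, which
    exists because all parts are positive. *)
Lemma mono_qsym_words n al : is_comp al ->
  mono_qsym n al =
  (\sum_(t : {ffun 'I_(sumn al) -> 'I_n} | word true al t) mon t)%R.
Proof.
move=> c_al; pose r := @row_ord _ (in_tuple al).
have pos (i : 'I_(size al)) : 0 < nth 0 al i.
  by move/all_nthP: c_al; apply.
pose first i : 'I_(sumn al) := Ordinal (flatten_indexP (pos i)).
have firstK i : row al (first i) = i by apply: flatten_indexKl.
pose h (t : {ffun 'I_(size al) -> 'I_n}) : {ffun 'I_(sumn al) -> 'I_n} :=
  [ffun u => t (r u)].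
pose h' (w : {ffun 'I_(sumn al) -> 'I_n}) : {ffun 'I_(size al) -> 'I_n} :=
  [ffun i => w (first i)].
rewrite [RHS](reindex_onto h h') => [|w /wordP[_ _ w3]]; last first.
  by apply/ffunP=> u; rewrite !ffunE; apply: w3 => //; rewrite firstK.
apply: eq_big => [t | t _].
  have -> : h' (h t) == t.
    apply/eqP/ffunP=> i; rewrite !ffunE; congr (t _).
    by apply: val_inj; rewrite /= -[RHS]firstK.
  rewrite andbT; apply/forallP/wordP => [F | [_ w2 _] i].
    have F' (u v : 'I_(sumn al)) : row al u < row al v -> t (r u) < t (r v).
      by move=> lt; have /forallP/(_ (r v))/implyP := F (r u); apply.
    split=> [u v le|u v|_ u v E]; rewrite ?ffunE //; last first.
    - by congr (t _); apply: val_inj.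
    - exact: F'.
    have := row_mono le (ltn_ord v); rewrite leq_eqVlt.
    case/orP => [/eqP E | /F'/ltnW //].
    by rewrite (_ : r u = r v) //; apply: val_inj.
  apply/forallP=> j; apply/implyP=> lt.
  have := w2 (first i) (first j); rewrite !firstK !ffunE => /(_ lt).
  by rewrite (_ : r (first i) = i) 1?(_ : r (first j) = j) //;
    apply: val_inj; apply: firstK.
under [RHS]eq_bigr do rewrite ffunE.
rewrite (@big_row _ (in_tuple al) _ _ _ (fun i => 'X_(t i)%R)).
by apply: eq_bigr => i _; rewrite prodr_const card_ord (tnth_nth 0).
Qed.

Definition qsym (mono : bool) n al : {mpoly int[n]} :=
  if mono then mono_qsym n al else fund_qsym n al.

Lemma qsym_words (mono : bool) n al : is_comp al ->
  qsym mono n al =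
  (\sum_(t : {ffun 'I_(sumn al) -> 'I_n} | word mono al t) mon t)%R.
Proof.
by case: mono; [apply: mono_qsym_words | apply: fund_qsym_words].
Qed.

(** * Zero padding yields quasisymmetric polynomials *)

Lemma is_comp_flat s : is_comp (flat s).
Proof. exact: filter_all. Qed.

Lemma flat_is_comp al : is_comp al -> flat al = al.
Proof. exact: all_filterP. Qed.

Lemma flat_nseq0 z : flat (nseq z 0) = [::].
Proof. by elim: z. Qed.

(** Low zeros raise every row index to the upper limit in [word_bounds], so the row bound is
    automatic. *)
Lemma slide_pad (mono : bool) n al (a : n.-tuple nat) : is_comp al ->
  a = nseq (n - size al) 0 ++ al :> seq nat -> slide mono a = qsym mono n al.
Proof.
move=> c_al Ea.
have fa : flat a = al by rewrite Ea filter_cat flat_nseq0 flat_is_comp.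
have sa : sumn al = sumn a by rewrite -fa sumn_flat.
have size_al : n = n - size al + size al.
  by rewrite -[in LHS](size_tuple a) Ea size_cat size_nseq.
rewrite qsym_words // (slide_words _ sa); apply: eq_bigl => t.
rewrite -(word_flat _ _ sa) fa; apply: andb_idr => w; apply/forallP => u.
by have [_] := word_bounds u erefl c_al w; rewrite Ea row_nseq_cat //; lia.
Qed.

(** High zeros leave row indices unchanged, so the lower limit in [word_bounds] is the Young
    bound. *)
Lemma young_slide_pad (mono : bool) n al (b : n.-tuple nat) : is_comp al ->
  b = al ++ nseq (n - size al) 0 :> seq nat ->
  young_slide mono b = qsym mono n al.
Proof.
move=> c_al Eb.
have fb : flat b = al by rewrite Eb filter_cat flat_nseq0 flat_is_comp ?cats0.
have sb : sumn al = sumn b by rewrite -fb sumn_flat.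
rewrite qsym_words // (young_slide_words _ sb); apply: eq_bigl => t.
rewrite -(word_flat _ _ sb) fb; apply: andb_idr => w; apply/forallP => u.
by have [] := word_bounds u erefl c_al w; rewrite Eb row_cat.
Qed.

(** * Row words, exponents and energy *)

(** The extremal word: largest for the slide bound, smallest for the Young bound, with exponent
    vector [a]. *)
Definition row_word n (a : n.-tuple nat) : {ffun 'I_(sumn a) -> 'I_n} :=
  [ffun u => row_ord u].

Lemma word_row (mono : bool) n (a : n.-tuple nat) : word mono a (row_word a).
Proof.
apply/wordP; split=> [u v le|u v|_ u v E]; rewrite !ffunE //.
  exact: row_mono.
exact: val_inj.
Qed.

Section Weights.
Local Open Scope ring_scope.

Definition weight n N (t : {ffun 'I_N -> 'I_n}) : 'X_{1..n} :=
  (\sum_u U_(t u))%MM.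

Lemma mon_weight n N (t : {ffun 'I_N -> 'I_n}) :
  mon t = 'X_[weight t] :> {mpoly int[n]}.
Proof.
by rewrite /weight (big_morph _ (@mpolyXD n int) (@mpolyX0 n int)).
Qed.

(** Coefficients are nonnegative, so no monomial cancels: one missing on the right would have
    coefficient 0 there and at least 1 on the left. *)
Lemma eq_sum_mpolyX n (I J : finType) (P : pred I) (Q : pred J)
    (f : I -> 'X_{1..n}) (g : J -> 'X_{1..n}) :
  \sum_(i | P i) 'X_[f i] = \sum_(j | Q j) 'X_[g j] :> {mpoly int[n]} ->
  forall i, P i -> exists2 j, Q j & g j = f i.
Proof.
move=> E i Pi.
have [/existsP[j /andP[Qj /eqP]] | /existsPn none] :=
  boolP [exists j, Q j && (g j == f i)]; first by exists j.
have := congr1 (mcoeff (f i)) E; rewrite !raddf_sum /= [RHS]big1 => [|j Qj].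
  move/Num.Theory.psumr_eq0P => /(_ _ i Pi); rewrite mcoeffX eqxx => one0.
  by suff: 1 = 0 :> int by []; apply: one0 => i' _; rewrite mcoeffX Num.Theory.ler0n.
by rewrite mcoeffX; have := none j; rewrite Qj /= => /negbTE ->.
Qed.

Lemma weight_row n (a : n.-tuple nat) i :
  weight (row_word a) i = tnth a i.
Proof.
rewrite /weight mnm_sumE; under eq_bigr do rewrite ffunE.
rewrite (@big_row _ a _ _ _ (fun j => U_(j)%MM i)).
rewrite (bigD1 i) //= [X in (_ + X)%N]big1 => [|j /negPf ji].
  by rewrite addn0 sum_nat_const card_ord mnm1E eqxx muln1.
by rewrite big1 // => c _; rewrite mnm1E ji.
Qed.

(** The degree with ['X_i] in degree [i]. It depends only on the monomial, yet on words it is the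
    sum of letters, hence strictly monotone for the pointwise order. *)
Definition energy n (m : 'X_{1..n}) : nat := (\sum_(i < n) m i * i)%N.

Lemma energy_weight n N (t : {ffun 'I_N -> 'I_n}) :
  energy (weight t) = (\sum_u t u)%N.
Proof.
have -> : energy (weight t) = (\sum_(i < n) \sum_u U_(t u)%MM i * i)%N.
  by apply: eq_bigr => i _; rewrite mnm_sumE big_distrl.
rewrite exchange_big /=; apply: eq_bigr => u _.
rewrite (bigD1 (t u)) //= big1 => [|j /negPf ju].
  by rewrite addn0 mnm1E eqxx mul1n.
by rewrite mnm1E eq_sym ju.
Qed.

Lemma energy_le_eq n N (t t' : {ffun 'I_N -> 'I_n}) :
  (forall u, t u <= t' u)%N -> (energy (weight t') <= energy (weight t))%N ->
  t = t'.
Proof.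
rewrite !energy_weight => le ge.
have [_ E] := leqif_sum (fun u (_ : predT u) => leqif_eq (le u)).
have : (\sum_u t u == \sum_u t' u)%N.
  by rewrite eqn_leq ge andbT; apply: leq_sum => u _.
rewrite E => /forallP H; apply/ffunP => u; apply/val_inj/eqP.
by have := H u.
Qed.

End Weights.

(** * Equality of a slide and a Young slide polynomial *)

Lemma tuple_exists n (s : seq nat) : size s = n ->
  exists a : n.-tuple nat, a = s :> seq nat.
Proof. by move=> /eqP sz; exists (Tuple sz). Qed.

(* [A] and [a] both occur as exponents on both sides, which bounds their
   energies by each other; equal energies turn [t <= r_a] into [t = r_a]. *)
Lemma slide_eq_young (mono : bool) n (a b : n.-tuple nat) :
  slide mono a = young_slide mono b ->
  a = nseq (n - size (flat b)) 0 ++ flat b :> seq nat.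
Proof.
move=> E; have c_al := is_comp_flat b.
have le_al : size (flat b) <= n.
  by rewrite size_filter -[X in _ <= X](size_tuple b) count_size.
have [|A EA] := @tuple_exists n (nseq (n - size (flat b)) 0 ++ flat b).
  by rewrite size_cat size_nseq subnK.
rewrite -EA.
have fA : flat A = flat b by rewrite EA filter_cat flat_nseq0 flat_is_comp.
have sA : sumn A = sumn (flat b) by rewrite -fA sumn_flat.
have sb : sumn A = sumn b by rewrite sA sumn_flat.
have rowA u : u < sumn A -> row A u = n - size (flat b) + row (flat b) u.
  by rewrite sA EA => lt_u; apply: row_nseq_cat.
(* The row word of [A] dominates all words for [b], being the upper limit in [word_bounds]. *)
have top (t : {ffun 'I_(sumn A) -> 'I_n}) u :
    word mono b t -> t u <= row_word A u.
  rewrite -(word_flat _ _ sb) => w; rewrite ffunE /= rowA //.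
  by have [_] := word_bounds u sA c_al w; lia.
have wA : word mono b (row_word A).
  by rewrite -(word_flat _ _ sb) -fA word_flat ?word_row.
move: E; rewrite (young_slide_words _ sb) (slide_words _ erefl).
rewrite !(eq_bigr _ (fun t _ => mon_weight t)) => E.
have [|t /andP[_ /forallP le_t] Et] := eq_sum_mpolyX (esym E) (i := row_word A).
  rewrite wA; apply/forallP=> u.
  (* The Young bound for the row word of [A] follows from [top], since the row word of [b] is itself
     a word for [b]. *)
  pose rb : {ffun 'I_(sumn A) -> 'I_n} := [ffun u => row_ord (cast_ord sb u)].
  have -> : row b u = rb u by rewrite ffunE.
  apply: top; apply/wordP.
  split=> [x y le|x y|_ x y e]; rewrite !ffunE //.
    by apply: row_mono; rewrite //= -sb.
  exact: val_inj.
(* Conversely the monomial of [a] comes from a word [t'] for [b], so its energy is at most that of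
   [A]. *)
have [|t' /andP[wt' _] Et'] := eq_sum_mpolyX E (i := row_word a).
  by rewrite word_row; apply/forallP=> u; rewrite ffunE.
have Ea : t = row_word a.
  apply: energy_le_eq => [u|]; first by rewrite ffunE; apply: le_t.
  rewrite Et -Et' !energy_weight; apply: leq_sum => u _; exact: top.
congr val; apply: eq_from_tnth => i.
by rewrite -!weight_row -Et Ea.
Qed.

Theorem slide_inter_young (mono : bool) n (p : {mpoly int[n]}) :
  (exists a : n.-tuple nat, p = slide mono a) /\
  (exists b : n.-tuple nat, p = young_slide mono b) <->
  (exists al, is_comp al /\ size al <= n /\ p = qsym mono n al).
Proof.
split=> [[[a ->] [b E]] | [al [c_al [le_al ->]]]].
  (* By [slide_eq_young], [a] is [flat b] padded with low zeros. *)
  exists (flat b); split; first exact: is_comp_flat.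
  split; first by rewrite size_filter -[X in _ <= X](size_tuple b) count_size.
  by apply: slide_pad; [apply: is_comp_flat | apply: slide_eq_young E].
split.
  have [|a Ea] := @tuple_exists n (nseq (n - size al) 0 ++ al).
    by rewrite size_cat size_nseq subnK.
  by exists a; rewrite (slide_pad _ c_al Ea).
have [|b Eb] := @tuple_exists n (al ++ nseq (n - size al) 0).
  by rewrite size_cat size_nseq subnKC.
by exists b; rewrite (young_slide_pad _ c_al Eb).
Qed.

Theorem mainTheorem13 (n : nat) :
  (forall p : {mpoly int[n]},
     (exists a : n.-tuple nat, p = fund_slide a) /\
     (exists b : n.-tuple nat, p = young_fund_slide b) <->
     (exists al : seq nat,
        is_comp al /\ size al <= n /\ p = fund_qsym n al)) /\
  (forall p : {mpoly int[n]},
     (exists a : n.-tuple nat, p = mono_slide a) /\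
     (exists b : n.-tuple nat, p = young_mono_slide b) <->
     (exists al : seq nat,
        is_comp al /\ size al <= n /\ p = mono_qsym n al)).
Proof.
split; [exact: (slide_inter_young false) | exact: (slide_inter_young true)].
Qed.
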